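(* Let $\beta>0$, let $x=(x_n)_{n\ge1}\in \ell^2(\mathbb{R})$ with $x_n\ge0$ for all $n$, and let $X=(X_n)_{n\ge1}$ be a weak solution of the inviscid dyadic system $$\dot X_n = k_{n-1}X_{n-1}^2-k_nX_nX_{n+1},\qquad X_n(0)=x_n,\qquad n\ge1,\ t\ge0,$$ with initial condition $x$. Then for all $\alpha>\frac13$ and for almost every $t>0$, $$\sup_{n\ge1}n^{-\alpha}k_n^{\frac13}X_n(t)<\infty.$$
   Context: Conventions: $k_n=2^{\beta n}$ for $n\ge1$, $k_0=0$ and $X_0\equiv0$. A weak solution is a sequence $X=(X_n)_{n\ge1}$ of real-valued differentiable functions on $[0,\infty)$ satisfying the system (equations and initial conditions) for all $n\ge1$ and $t\ge0$. ''Almost every'' refers to Lebesgue measure. *)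

(* Defs.v *)
From HB Require Import structures.
From mathcomp Require Export all_boot all_order all_algebra.
From mathcomp Require Export all_classical all_reals all_analysis.

Set Implicit Arguments.
Unset Strict Implicit.
Unset Printing Implicit Defensive.

Import Order.TTheory GRing.Theory Num.Theory.
Import numFieldNormedType.Exports.

Local Open Scope classical_set_scope.
Local Open Scope ring_scope.

(* Sequences (u_n)_{n >= 1} are functions on [nat]. The value at index 0 is
   ignored, except that solutions satisfy the convention X_0 = 0. *)

Definition dyadic_coef (R : realType) (beta : R) (n : nat) : R :=
  if n is 0%N then 0 else 2 `^ (beta * n%:R).

Definition in_ell2 (R : realType) (x : nat -> R) : Prop :=
  (\sum_(1 <= n <oo) (`|x n| ^+ 2)%:E < +oo)%E.

(* The limit is taken inside A: for A = [0, +oo[ this is the ordinary two-sided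
   derivative at t > 0 and the right derivative at t = 0, so the values of f on
   ]-oo, 0[ play no role. *)
Definition has_derivative_within (R : realType) (A : set R) (f : R -> R)
    (t l : R) : Prop :=
  (f s - f t) / (s - t) @[s --> within A t^'] --> l.

Definition weak_solution (R : realType) (beta : R) (x : nat -> R)
    (X : nat -> R -> R) : Prop :=
  [/\ forall t : R, 0 <= t -> X 0%N t = 0,
      forall n : nat, (1 <= n)%N -> X n 0 = x n
    & forall (n : nat) (t : R), (1 <= n)%N -> 0 <= t ->
        has_derivative_within `[0, +oo[ (X n) t
          (dyadic_coef beta n.-1 * X n.-1 t ^+ 2
           - dyadic_coef beta n * X n t * X n.+1 t)].

(* Main.v *)
Require Import Defs.
From mathcomp Require Import all_boot all_order all_algebra.
From mathcomp Require Import all_classical all_reals all_analysis.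
From mathcomp Require Import measurable_realfun ring lra.
Import Order.TTheory GRing.Theory Num.Theory.
Import numFieldNormedType.Exports.
Local Open Scope classical_set_scope.
Local Open Scope ring_scope.
Set Implicit Arguments.
Unset Strict Implicit.
Unset Printing Implicit Defensive.

(** The theorem follows from a bound on the time integral of [k_n X_n^3] that
    is uniform in [n]: on every [[0, T]],
      [int_0^T k_n X_n^3 dt <= 12 lambda^2 E], where [lambda = 2 ^ beta] and
    [E] bounds the initial energy [sum_n x_n^2].
    As [3 alpha > 1], the series [sum_n n^(- 3 alpha)] converges, so
    [sum_n n^(- 3 alpha) k_n X_n^3] is integrable on [[0, T]] and hence finite
    at almost every [t]. Each of its terms, which are the cubes of
    [n^(- alpha) k_n^(1/3) X_n(t)], is then bounded by the sum.

    The solution stays nonnegative, because [X_n' >= - k_n X_(n+1) X_n]. The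
    energy [e_n] of the first [n] modes then satisfies
    [e_n' = - 2 k_n X_n^2 X_(n+1) <= 0]: each [X_n] is bounded by [sqrt E], and
    every energy flux [f_n = k_n X_n^2 X_(n+1)] has time integral at most [E / 2].

    The cubic bound comes from the product of two consecutive modes:
      [(X_n X_(n+1))' = k_n X_n^3 + k_(n-1) X_(n-1)^2 X_(n+1)
         - k_n X_n X_(n+1)^2 - k_(n+1) X_n X_(n+1) X_(n+2)].
    The left-hand side integrates to at most [E]. The two negative terms are
    split by Young's inequality into a large multiple of the fluxes [f_n] and
    [f_(n+1)], which is integrable, and a small multiple of the cubic terms at
    [n], [n+1] and [n+2] ([dyadic_flux_ineq]). With
    [a_n = int_0^T k_n X_n^3 dt] this reads
      [a_n <= C + (a_(n+1) + a_(n+2)) / (4 lambda^2)]  ([dyadic_cube_step]).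
    The crude bound [a_n = O(lambda^n)], which holds because the modes are
    bounded, grows slowly enough for this recursion to be iterated to
    infinity, and what remains is [a_n <= 2 C] ([two_step_recursion_bound]). *)

(** * Calculus on a time interval *)

Lemma has_derivative_within_cvg (R : realType) (A : set R) (f : R -> R)
    (t l : R) :
  has_derivative_within A f t l -> f s @[s --> within A (nbhs t)] --> f t.
Proof.
move=> fl.
have ct : (s - t) @[s --> within A t^'] --> 0.
  have -> : (0 : R) = t - t by rewrite subrr.
  apply: cvgB; last exact: cvg_cst.
  by do 2 apply: cvg_within_filter; exact: cvg_id.
have FF : Filter (within A t^') by exact: within_filter.
have := @cvgM _ _ _ FF _ _ _ _ fl ct; rewrite mulr0 => /cvgrPdist_lt h.
apply/cvgrPdist_lt => e e0; have := h _ e0.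
rewrite !near_withinE; apply: filterS => s sP As.
have [->|st] := eqVneq s t; first by rewrite subrr normr0.
have /= := sP st As; rewrite divfK ?subr_eq0//.
by rewrite sub0r normrN distrC.
Qed.

Lemma has_derivative_within_is_derive (R : realType) (A : set R) (f : R -> R)
    (t l : R) :
  nbhs t A -> has_derivative_within A f t l -> is_derive t 1 f l.
Proof.
move=> At /cvgrPdist_lt fl.
have fl' : h^-1 *: ((f \o shift t) (h *: 1) - f t) @[h --> 0^'] --> l.
  apply/cvgrPdist_lt => e e0; have := fl _ e0.
  rewrite !near_withinE => /nbhs0P.
  move: At => /nbhs0P; apply: filterS2 => h Ath hP h0 /=.
  have := hP; rewrite (addrC t h) addrK.
  have hn : h + t != t by rewrite -subr_eq0 addrK.
  rewrite addrC in Ath; move=> /(_ hn Ath).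
  by rewrite [h *: 1]mulr1 [_ *: _]mulrC.
apply: DeriveDef; first by apply/cvg_ex; exists l.
exact: cvg_lim fl'.
Qed.

(** Continuity up to the endpoints and a derivative in the interior are what the
    mean value theorem needs, and both are at hand for the modes of a solution
    and for the integral of a continuous function. *)
Definition primitive_on (R : realType) (T : R) (f df : R -> R) : Prop :=
  {within `[0, T], continuous f} /\
  (forall t, 0 < t < T -> is_derive t 1 f (df t)).

Lemma primitive_onD (R : realType) (T : R) (f df g dg : R -> R) :
  primitive_on T f df -> primitive_on T g dg ->
  primitive_on T (fun t => f t + g t) (fun t => df t + dg t).
Proof.
move=> [cf df'] [cg dg']; split.
  by move=> t; apply: cvgD; [exact: cf|exact: cg].
by move=> t tT; apply: is_deriveD; [exact: df'|exact: dg'].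
Qed.

Lemma primitive_onM (R : realType) (T : R) (f df g dg : R -> R) :
  primitive_on T f df -> primitive_on T g dg ->
  primitive_on T (fun t => f t * g t) (fun t => f t * dg t + g t * df t).
Proof.
move=> [cf df'] [cg dg']; split.
  by move=> t; apply: cvgM; [exact: cf|exact: cg].
by move=> t tT; apply: is_deriveM; [exact: df'|exact: dg'].
Qed.

Lemma primitive_on_cst (R : realType) (T c : R) :
  primitive_on T (fun=> c) (fun=> 0).
Proof. by split=> [t|t tT]; [exact: cvg_cst|exact: is_derive_cst]. Qed.

Lemma primitive_on_id (R : realType) (T : R) :
  primitive_on T (fun t => t) (fun=> 1).
Proof.
split=> [|t tT]; last exact: is_derive_id.
by apply: continuous_subspaceT => t; exact: cvg_id.
Qed.

Lemma primitive_onZ (R : realType) (T c : R) (f df : R -> R) :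
  primitive_on T f df ->
  primitive_on T (fun t => c * f t) (fun t => c * df t).
Proof.
move=> pf; have := primitive_onM (primitive_on_cst T c) pf.
by under [X in primitive_on _ _ X]eq_fun do rewrite mulr0 addr0.
Qed.

Lemma primitive_on_le (R : realType) (T : R) (f df : R -> R) :
  0 < T -> primitive_on T f df -> (forall t, 0 < t < T -> 0 <= df t) ->
  f 0 <= f T.
Proof.
move=> T0 [cf df'] df0.
have [c cT fE] := MVT T0 (fun t tT => df' t tT) cf.
rewrite -subr_ge0 fE; apply: mulr_ge0; first exact: df0.
by rewrite subr0 ltW.
Qed.

Lemma primitive_onW (R : realType) (S T : R) (f df : R -> R) :
  S <= T -> primitive_on T f df -> primitive_on S f df.
Proof.
move=> ST [cf df']; split.
  by apply: continuous_subspaceW cf; apply: subset_itvl; rewrite bnd_simp.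
by move=> t /andP[t0 tS]; apply: df'; rewrite t0 (lt_le_trans tS).
Qed.

(** Integrals are turned into values of primitives, so that the estimates below
    are monotonicity statements for explicit combinations of functions. *)
Lemma primitive_exists (R : realType) (T : R) (f : R -> R) :
  0 < T -> {within `[0, T], continuous f} ->
  exists F : R -> R, [/\ F 0 = 0, primitive_on T F f &
    (\int[@lebesgue_measure R]_(t in `[0%R, T]) (f t)%:E = (F T)%:E)%E].
Proof.
move=> T0 cf.
have If : (@lebesgue_measure R).-integrable `[0, T] (EFin \o f).
  by apply: continuous_compact_integrable => //; exact: segment_compact.
exists (fun t => parameterized_integral (@lebesgue_measure R) 0 t f); split.
- by rewrite /parameterized_integral set_itv1 Rintegral_set1.
- split; first by apply: parameterized_integral_continuous => //; exact: ltW.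
  move=> t /andP[t0 tT].
  have ct : {for t, continuous f}.
    by apply: (within_continuous_continuous T0 cf); rewrite in_itv/= t0 tT.
  have [] := continuous_FTC1_closed tT If t0 ct.
  by rewrite derive1E => dF <-; apply: DeriveDef.
- by rewrite /parameterized_integral /Rintegral fineK//; exact: integrable_fin_num.
Qed.

Lemma eq_primitive_on (R : realType) (T : R) (f df dg : R -> R) :
  (forall t, 0 < t < T -> df t = dg t) -> primitive_on T f df -> primitive_on T f dg.
Proof. by move=> fg [cf df']; split=> // t tT; rewrite -fg//; exact: df'. Qed.

Lemma primitive_on_expR (R : realType) (T : R) (f df : R -> R) :
  primitive_on T f df ->
  primitive_on T (fun t => expR (f t)) (fun t => expR (f t) * df t).
Proof.
move=> [cf df']; split.
  move=> t; apply: (@continuous_comp (subspace `[0, T]) _ _ f expR).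
    exact: cf.
  exact: continuous_expR.
move=> t tT; have dft := df' _ tT.
exact: (@is_derive1_comp _ expR f t (expR (f t)) (df t)).
Qed.

(** With [B] a primitive of [b], the function [f * expR B] is nondecreasing. *)
Lemma gronwall_ge0 (R : realType) (T : R) (f df b : R -> R) :
  0 < T -> primitive_on T f df -> {within `[0, T], continuous b} ->
  (forall t, 0 < t < T -> - b t * f t <= df t) -> 0 <= f 0 -> 0 <= f T.
Proof.
move=> T0 pf cb fdf f0.
have [B [B0 pB _]] := primitive_exists T0 cb.
have pfB := primitive_onM pf (primitive_on_expR pB).
have := primitive_on_le T0 pfB.
rewrite B0 expR0 mulr1 => fT.
have : 0 <= f T * expR (B T).
  apply: le_trans f0 (fT _) => t tT.
  rewrite (_ : _ + _ = expR (B t) * (df t - (- b t * f t))); last by ring.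
  by rewrite mulr_ge0 ?expR_ge0// subr_ge0 fdf.
by rewrite pmulr_lge0 ?expR_gt0.
Qed.

(** * Absorption of the transfer terms, and the recursion it leads to *)

(** Here [a], [b], [c] stand for three consecutive modes, and the common factor
    [k_n] is divided out. The first bracket on the right collects the two
    fluxes and the second one the cubic terms. The difference of the two sides
    is a combination, with nonnegative coefficients, of two completed squares,
    of [b^3], of [c^3] and of [a^3 + c^3 - a^2 c]; this last expression is
    nonnegative. *)
Lemma dyadic_flux_ineq (R : realType) (l a b c : R) :
  1 <= l -> 0 <= a -> 0 <= b -> 0 <= c ->
  a * b ^+ 2 + l * a * b * c <=
  2 * l ^+ 2 * (a ^+ 2 * b + l * b ^+ 2 * c) +
  (l * a ^+ 3 + l * b ^+ 3 + l ^+ 2 * c ^+ 3) / (8 * l ^+ 2).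
Proof.
move=> l1 a0 b0 c0.
have l0 : 0 < l by apply: lt_le_trans l1.
have ln0 : l != 0 by rewrite gt_eqF.
rewrite -subr_ge0.
rewrite [leRHS](_ : _ = b * (2 * l ^+ 2) * (a - b / (4 * l ^+ 2)) ^+ 2 +
  l * c * (2 * l ^+ 2) * (b - a / (4 * l ^+ 2)) ^+ 2 +
  ((l - 1) * b ^+ 3 + l * (a ^+ 3 + c ^+ 3 - a ^+ 2 * c) + l * (l - 1) * c ^+ 3)
   / (8 * l ^+ 2)); last by field.
have acge : 0 <= a ^+ 3 + c ^+ 3 - a ^+ 2 * c.
  have [ac|/ltW ca] := leP a c.
    rewrite (_ : _ - _ = a ^+ 3 + c * ((c - a) * (c + a))); last by ring.
    by rewrite addr_ge0 ?exprn_ge0// !mulr_ge0// ?subr_ge0 ?addr_ge0.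
  rewrite (_ : _ - _ = c ^+ 3 + a ^+ 2 * (a - c)); last by ring.
  by rewrite addr_ge0 ?exprn_ge0// mulr_ge0 ?sqr_ge0// subr_ge0.
have l2 : 0 <= 2 * l ^+ 2 by rewrite mulr_ge0// sqr_ge0.
have lm1 : 0 <= l - 1 by rewrite subr_ge0.
have l8 : 0 <= 8 * l ^+ 2 by rewrite mulr_ge0// sqr_ge0.
have l00 := ltW l0.
apply: addr_ge0; first by apply: addr_ge0; apply: mulr_ge0; rewrite ?sqr_ge0// !mulr_ge0.
apply: divr_ge0 => //; apply: addr_ge0; last by rewrite mulr_ge0 ?exprn_ge0// mulr_ge0.
by apply: addr_ge0; rewrite mulr_ge0 ?exprn_ge0.
Qed.

(** By induction on [j], [a m <= 2 C + D l^m / 2^j] for all [m]: one step of the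
    recursion multiplies the error by at most [(l + l^2) / (4 l^2) <= 1 / 2]. *)
Lemma two_step_recursion_bound (R : realType) (l C D : R) (a : nat -> R) :
  1 <= l -> 0 <= C -> 0 <= D ->
  (forall n, a n <= C + (a n.+1 + a n.+2) / (4 * l ^+ 2)) ->
  (forall n, a n <= D * l ^+ n) ->
  forall n, a n <= 2 * C.
Proof.
move=> l1 C0 D0 aS aD n.
have l0 : 0 < l by apply: lt_le_trans l1.
have l40 : 0 < 4 * l ^+ 2 by rewrite mulr_gt0// exprn_gt0.
have main j m : a m <= 2 * C + D * l ^+ m / 2 ^+ j.
  elim: j m => [|j ih] m.
    by rewrite expr0 divr1 (le_trans (aD m))// lerDr mulr_ge0.
  apply: le_trans (aS m) _.
  rewrite [leRHS](_ : _ = C + (C + D * l ^+ m / 2 ^+ j.+1)); last by ring.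
  rewrite lerD2l ler_pdivrMr//.
  apply: le_trans (lerD (ih m.+1) (ih m.+2)) _.
  rewrite !exprS invfM; set q := D * _; set r := _^-1.
  have q0 : 0 <= D * l ^+ m * (2 ^+ j)^-1.
    by rewrite !mulr_ge0 ?invr_ge0 ?exprn_ge0// ltW.
  rewrite -subr_ge0 (_ : _ - _ = 4 * C * (l ^+ 2 - 1) +
    (D * l ^+ m * (2 ^+ j)^-1) * (l * (l - 1))); last by rewrite /q /r; field.
  have l21 : 0 <= l ^+ 2 - 1 by rewrite subr_ge0 exprn_ege1.
  apply: addr_ge0; first by rewrite !mulr_ge0.
  by apply: mulr_ge0 => //; rewrite mulr_ge0 ?subr_ge0// ltW.
apply/ler_addgt0Pr => e e0.
have q0 : 0 <= D * l ^+ n by rewrite mulr_ge0 ?exprn_ge0// ltW.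
have := archi_boundP (divr_ge0 q0 (ltW e0)); set j := Num.bound _ => qj.
apply: le_trans (main j n) _; rewrite lerD2l ler_pdivrMr ?exprn_gt0//.
move: qj; rewrite ltr_pdivrMr// => /ltW/le_trans; apply.
by rewrite mulrC ler_pM2l// -natrX ler_nat ltnW// ltn_expl.
Qed.

(** * The energy and cubic estimates of nonnegative solutions *)

Lemma weak_solution_primitive_on (R : realType) (beta T : R) (x : nat -> R)
    (X : nat -> R -> R) (n : nat) :
  weak_solution beta x X ->
  primitive_on T (X n.+1) (fun t =>
    dyadic_coef beta n * X n t ^+ 2 -
    dyadic_coef beta n.+1 * X n.+1 t * X n.+2 t).
Proof.
move=> [_ _ dX]; split.
  apply/subspace_continuousP => t /=; rewrite in_itv/= => /andP[t0 _].
  have := has_derivative_within_cvg (dX n.+1 t isT t0).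
  apply: cvg_trans; apply: cvg_app; apply: within_subset => s /=.
  by rewrite !in_itv/= => /andP[->].
move=> t /andP[t0 _].
apply: has_derivative_within_is_derive (dX n.+1 t isT (ltW t0)).
apply: filterS (lt_nbhsr t0) => s s0 /=.
by rewrite in_itv/= ltW.
Qed.

Definition energy (R : realType) (X : nat -> R -> R) (n : nat) (t : R) : R :=
  \sum_(j < n) X j.+1 t ^+ 2.

Lemma energy_ge0 (R : realType) (X : nat -> R -> R) n t : 0 <= energy X n t.
Proof. by rewrite sumr_ge0// => j _; rewrite sqr_ge0. Qed.

(** The estimates are uniform in [T]: their constants depend only on the ratio
    [lambda] of the coefficients and on the bound [E] of the initial energy. *)
Section dyadic.
Context {R : realType}.
Variables (lambda : R) (k : nat -> R) (T : R) (X : nat -> R -> R) (E : R).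
Hypothesis lambda1 : 1 <= lambda.
Hypothesis k0 : k 0%N = 0.
Hypothesis k1 : 0 < k 1%N.
Hypothesis kS : forall n, k n.+2 = lambda * k n.+1.
Hypothesis T0 : 0 < T.
Hypothesis dX : forall n, primitive_on T (X n.+1)
  (fun t => k n * X n t ^+ 2 - k n.+1 * X n.+1 t * X n.+2 t).
Hypothesis X0 : forall n, 0 <= X n.+1 0.
Hypothesis XE : forall n, \sum_(j < n) X j.+1 0 ^+ 2 <= E.

Let k_gt0 n : 0 < k n.+1.
Proof. by elim: n => // n ih; rewrite kS mulr_gt0// (lt_le_trans ltr01). Qed.

Let k_ge0 n : 0 <= k n.
Proof. by case: n => [|n]; [rewrite k0|exact: ltW]. Qed.

Lemma dyadic_ge0 n t : 0 <= t <= T -> 0 <= X n.+1 t.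
Proof.
move=> /andP[]; rewrite le_eqVlt => /predU1P[<- _|t0 tT]; first exact: X0.
apply: (gronwall_ge0 t0 (primitive_onW tT (dX n))
  (b := fun s => k n.+1 * X n.+2 s)) => //.
- have [cX _] := primitive_onZ (k n.+1) (primitive_onW tT (dX n.+1)).
  exact: cX.
- (* The defect is the inflow from the previous mode. *)
  move=> s _; rewrite -subr_ge0 (_ : _ - _ = k n * X n s ^+ 2); last by ring.
  by rewrite mulr_ge0// sqr_ge0.
Qed.

(** The sum telescopes: what mode [j] loses is what mode [j + 1] gains. *)
Lemma primitive_on_energy n : primitive_on T (energy X n)
  (fun t => - (2 * k n * X n t ^+ 2 * X n.+1 t)).
Proof.
elim: n => [|n ih].
  rewrite /energy; under eq_fun do rewrite big_ord0.
  apply: eq_primitive_on (primitive_on_cst T 0) => t _; rewrite k0; ring.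
rewrite /energy; under eq_fun do rewrite big_ord_recr/= expr2.
by apply: eq_primitive_on (primitive_onD ih (primitive_onM (dX n) (dX n))) => t _; ring.
Qed.

Lemma energy_le n t : 0 <= t <= T -> energy X n t <= E.
Proof.
move=> /andP[]; rewrite le_eqVlt => /predU1P[<- _|t0 tT]; first exact: XE.
apply: le_trans (XE n).
have := primitive_onZ (-1) (primitive_onW tT (primitive_on_energy n)).
move=> /(primitive_on_le t0); rewrite !mulN1r lerN2; apply => s /andP[s0 st].
rewrite mulN1r opprK; case: n => [|n]; first by rewrite k0 mulr0 !mul0r.
rewrite mulr_ge0//; last first.
  by apply: dyadic_ge0; rewrite ltW//= (le_trans (ltW st)).
by apply: mulr_ge0; rewrite ?sqr_ge0// mulr_ge0 ?k_ge0.
Qed.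

Lemma dyadic_sqr_le n t : 0 <= t <= T -> X n.+1 t ^+ 2 <= E.
Proof.
move=> tT; apply: le_trans (energy_le n.+1 tT).
by rewrite /energy big_ord_recr/= lerDr energy_ge0.
Qed.

Lemma dyadic_cube_continuous n :
  {within `[0, T], continuous (fun t => k n.+1 * X n.+1 t ^+ 3)}.
Proof.
have [cX _] := primitive_onZ (k n.+1)
  (primitive_onM (dX n) (primitive_onM (dX n) (dX n))).
exact: cX.
Qed.

Lemma dyadic_cube_primitive n : exists A : R -> R, [/\ A 0 = 0,
  primitive_on T A (fun t => k n.+1 * X n.+1 t ^+ 3) &
  (\int[@lebesgue_measure R]_(t in `[0%R, T]) (k n.+1 * X n.+1 t ^+ 3)%:E
   = (A T)%:E)%E].
Proof.
apply: primitive_exists => //; exact: dyadic_cube_continuous.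
Qed.

(** The function
      [W = X_n X_(n+1) - lambda^2 (e_n + e_(n+1))
         + (A_(n+1) + A_(n+2)) / (8 lambda^2) - (1 - lambda / (8 lambda^2)) A_n]
    is nondecreasing by [dyadic_flux_ineq], where [e_n] is the energy and [A_n]
    the primitive of the cubic term; the energy stands for the integrated
    flux. *)
Lemma dyadic_cube_step (A : nat -> R -> R) n :
  (forall m, A m 0 = 0) ->
  (forall m, primitive_on T (A m) (fun t => k m.+1 * X m.+1 t ^+ 3)) ->
  A n T <= 6 * lambda ^+ 2 * E + (A n.+1 T + A n.+2 T) / (4 * lambda ^+ 2).
Proof.
move=> A0 pA.
have l0 : 0 < lambda by apply: lt_le_trans lambda1.
have ln0 : lambda != 0 by rewrite gt_eqF.
have X_ge0 m t : 0 < t < T -> 0 <= X m.+1 t.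
  by move=> /andP[t0 tT]; apply: dyadic_ge0; rewrite !ltW.
have T00 : 0 <= T <= T by rewrite lexx ltW.
have AT : 0 <= A n T.
  rewrite -[leLHS](A0 n); apply: (primitive_on_le T0 (pA n)) => t tT.
  by rewrite mulr_ge0 ?k_ge0// exprn_ge0 ?X_ge0.
(* The function differentiated in [pW] is the [W] described above. *)
have pW := primitive_onD (primitive_onD (primitive_onD
  (primitive_onM (dX n) (dX n.+1))
  (primitive_onZ (- lambda ^+ 2)
    (primitive_onD (primitive_on_energy n.+1) (primitive_on_energy n.+2))))
  (primitive_onZ (8 * lambda ^+ 2)^-1 (primitive_onD (pA n.+1) (pA n.+2))))
  (primitive_onZ (- (1 - lambda / (8 * lambda ^+ 2))) (pA n)).
have := primitive_on_le T0 pW; rewrite !A0 addr0 !mulr0 !addr0 => WT.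
have {}WT : X n.+1 0 * X n.+2 0 - lambda ^+ 2 * (energy X n.+1 0 + energy X n.+2 0)
  <= X n.+1 T * X n.+2 T - lambda ^+ 2 * (energy X n.+1 T + energy X n.+2 T)
   + (8 * lambda ^+ 2)^-1 * (A n.+1 T + A n.+2 T)
   - (1 - lambda / (8 * lambda ^+ 2)) * A n T.
  rewrite -!(mulNr (lambda ^+ 2)) -(mulNr (1 - _)); apply: WT => t tT.
  have := dyadic_flux_ineq lambda1 (X_ge0 n _ tT) (X_ge0 n.+1 _ tT) (X_ge0 n.+2 _ tT).
  rewrite -subr_ge0 => /(mulr_ge0 (k_ge0 n.+1)) flux.
  (* The inflow term [k_(n-1) X_(n-1)^2 X_(n+1)] has the favourable sign. *)
  have gain : 0 <= k n * X n t ^+ 2 * X n.+2 t.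
    by apply: mulr_ge0; [rewrite mulr_ge0 ?k_ge0 ?sqr_ge0|exact: X_ge0].
  apply: le_trans (addr_ge0 flux gain) _.
  by rewrite !kS le_eqVlt; apply/orP; left; apply/eqP; field.
have E0 : 0 <= X n.+1 0 * X n.+2 0 by rewrite mulr_ge0.
have e1 := XE n.+1; have e2 := XE n.+2.
have f1 := energy_ge0 X n.+1 T; have f2 := energy_ge0 X n.+2 T.
have g1 := dyadic_sqr_le n T00; have g2 := dyadic_sqr_le n.+1 T00.
have prod : X n.+1 T * X n.+2 T <= E.
  have := sqr_ge0 (X n.+1 T - X n.+2 T); rewrite sqrrB; lra.
have l21 : 1 <= lambda ^+ 2 by rewrite exprn_ege1.
have Ege : 0 <= E by apply: le_trans (energy_ge0 X n.+1 0) e1.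
have u1 : lambda ^+ 2 * (energy X n.+1 0 + energy X n.+2 0) <= lambda ^+ 2 * (E + E).
  by rewrite ler_wpM2l ?sqr_ge0// lerD.
have u2 : 0 <= lambda ^+ 2 * (energy X n.+1 T + energy X n.+2 T).
  by rewrite mulr_ge0 ?sqr_ge0// addr_ge0.
have u3 : E <= lambda ^+ 2 * E by rewrite ler_peMl.
have u4 : A n T / 2 <= (1 - lambda / (8 * lambda ^+ 2)) * A n T.
  rewrite mulrC ler_wpM2r// (_ : lambda / _ = (8 * lambda)^-1); last by field.
  have : (8 * lambda)^-1 <= 8^-1 by rewrite lef_pV2 ?posrE ?mulr_gt0// ler_peMr.
  lra.
have -> : (A n.+1 T + A n.+2 T) / (4 * lambda ^+ 2) =
  2 * ((8 * lambda ^+ 2)^-1 * (A n.+1 T + A n.+2 T)) by field.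
set q := (8 * _)^-1 * _ in WT *.
lra.
Qed.

Lemma dyadic_cube_integral_le n :
  (\int[@lebesgue_measure R]_(t in `[0%R, T]) (k n.+1 * X n.+1 t ^+ 3)%:E
   <= (12 * lambda ^+ 2 * E)%:E)%E.
Proof.
have [A AP] := choice dyadic_cube_primitive.
have A0 m : A m 0 = 0 by have [] := AP m.
have pA m : primitive_on T (A m) (fun t => k m.+1 * X m.+1 t ^+ 3) by have [] := AP m.
have [_ _ ->] := AP n; rewrite lee_fin.
have Ege : 0 <= E by apply: le_trans (XE 0%N); rewrite big_ord0.
have E10 : 0 <= 1 + E by rewrite addr_ge0.
have -> : 12 * lambda ^+ 2 * E = 2 * (6 * lambda ^+ 2 * E) by ring.
apply: (@two_step_recursion_bound R lambda _ (k 1 * (1 + E) ^+ 3 * T)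
  (fun m => A m T)) => //.
- by apply: mulr_ge0 => //; rewrite mulr_ge0 ?sqr_ge0.
- by apply: mulr_ge0; [rewrite mulr_ge0 ?exprn_ge0// ltW|exact: ltW].
- by move=> m; exact: dyadic_cube_step.
move=> m.
have km : k m.+1 = k 1%N * lambda ^+ m.
  elim: m => [|m ih]; first by rewrite mulr1.
  by rewrite kS ih exprS; ring.
have := primitive_onD
  (primitive_onZ (k m.+1 * (1 + E) ^+ 3) (primitive_on_id T))
  (primitive_onZ (-1) (pA m)).
move=> /(primitive_on_le T0); rewrite A0 !mulr0 addr0 mulN1r subr_ge0 km => AT.
rewrite (_ : _ * _ = k 1%N * lambda ^+ m * (1 + E) ^+ 3 * T); last by ring.
apply: AT => t /andP[t0 tT].
have tT' : 0 <= t <= T by rewrite !ltW.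
rewrite -km mulr1 mulN1r subr_ge0 ler_wpM2l ?k_ge0//.
have Xt0 := dyadic_ge0 m tT'.
rewrite lerXn2r ?nnegrE//.
rewrite -ler_sqr ?nnegrE//; apply: le_trans (dyadic_sqr_le m tT') _.
(* [1 + E] serves as a polynomial substitute for [sqrt E]. *)
rewrite sqrrD; have := sqr_ge0 E; lra.
Qed.

End dyadic.

(** * From integral bounds to pointwise bounds *)

(** A discrete form of the fact that the derivative of [- x^(- s)] is
    [s x^(- 1 - s)]: after division by [(m + 1)^(- s)] it follows from
    [expR u >= 1 + u] and [ln ((m + 1) / m) >= 1 / (m + 1)]. *)
Lemma powR_telescope (R : realType) (s m : R) : 0 < s -> 0 < m ->
  s * (m + 1) `^ (- (1 + s)) <= m `^ (- s) - (m + 1) `^ (- s).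
Proof.
move=> s0 m0.
have m10 : 0 < m + 1 by rewrite addr_gt0.
have lnm : (m + 1)^-1 <= ln (m + 1) - ln m.
  have := @le_ln1Dx _ (- (m + 1)^-1).
  rewrite ltrN2 invf_lt1// ltrDr => /(_ m0).
  rewrite (_ : 1 + - _ = m / (m + 1)); last by field; rewrite gt_eqF.
  by rewrite ln_div ?posrE// lerNr opprB.
have -> : m `^ (- s) = (m + 1) `^ (- s) * expR (s * (ln (m + 1) - ln m)).
  rewrite /powR !gt_eqF// -expRD; congr expR; ring.
have -> : (m + 1) `^ (- (1 + s)) = (m + 1) `^ (- s) / (m + 1).
  by rewrite opprD powRD ?(gt_eqF m10) ?implybT// powR_inv1 ?ltW// mulrC.
rewrite -[X in _ - X]mulr1 -mulrBr mulrCA ler_wpM2l ?powR_ge0//.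
rewrite lerBrDl; apply: le_trans (expR_ge1Dx _).
by rewrite lerD2l ler_wpM2l// ltW.
Qed.

Lemma p_series_le (R : realType) (s : R) (N : nat) : 0 < s ->
  \sum_(n < N) n.+1%:R `^ (- (1 + s)) <= 1 + s^-1.
Proof.
move=> s0.
case: N => [|N]; first by rewrite big_ord0 addr_ge0// invr_ge0 ltW.
suff : s * \sum_(n < N.+1) n.+1%:R `^ (- (1 + s)) <= s + 1 - N.+1%:R `^ (- s).
  move=> h; rewrite -(ler_pM2l s0) mulrDr mulr1 mulfV ?gt_eqF//.
  by apply: le_trans h _; rewrite gerBl powR_ge0.
elim: N => [|N ih].
  by rewrite big_ord_recr big_ord0/= add0r !powR1 mulr1 addrK.
rewrite big_ord_recr/= mulrDr.
have := @powR_telescope R s N.+1%:R s0 (ltr0Sn _ _).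
rewrite -natr1 in ih *; rewrite -[N.+2%:R]natr1 -[N.+1%:R]natr1; lra.
Qed.

(** By monotone convergence the function [sum_n w_n g_n] is integrable, so it is
    finite almost everywhere, and it dominates each of its terms. *)
Lemma ae_bounded_of_summable_integral (d : measure_display)
    (T : measurableType d) (R : realType) (mu : {measure set T -> \bar R})
    (D : set T) (g : nat -> T -> R) (w : nat -> R) (C S : R) :
  measurable D -> (forall n, measurable_fun D (g n)) ->
  (forall n t, D t -> 0 <= g n t) -> (forall n, 0 <= w n) -> 0 <= C ->
  (forall n, (\int[mu]_(t in D) (g n t)%:E <= C%:E)%E) ->
  (forall N, \sum_(n < N) w n <= S) ->
  {ae mu, forall t, D t -> exists M, forall n, w n * g n t <= M}.
Proof.
move=> mD mg g0 w0 C0 gC wS.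
pose f n t := ((w n)%:E * (g n t)%:E)%E.
have f0 n t : D t -> (0 <= f n t)%E by move=> Dt; rewrite mule_ge0 ?lee_fin ?g0.
have mgE n : measurable_fun D (EFin \o g n) by exact/measurable_EFinP.
have mf n : measurable_fun D (f n) by apply: measurable_funeM; exact: mgE.
pose F t := (\sum_(n <oo) f n t)%E.
have F0 t : D t -> (0 <= F t)%E by move=> Dt; apply: nneseries_ge0 => n _ _; exact: f0.
have intF : (\int[mu]_(t in D) F t <= (C * S)%:E)%E.
  rewrite integral_nneseries//; apply: lime_le.
    by apply: is_cvg_nneseries => n _ _; apply: integral_ge0 => t; exact: f0.
  near=> N; apply: (@le_trans _ _ (\sum_(0 <= n < N) (w n * C)%:E)%E).
    apply: lee_sum => n _; rewrite ge0_integralZl_EFin ?EFinM ?lee_wpmul2l ?lee_fin//.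
      by move=> t Dt; rewrite lee_fin g0.
    exact: mgE.
  by rewrite big_mkord sumEFin lee_fin -mulr_suml mulrC ler_wpM2l.
have iF : mu.-integrable D F.
  apply/integrableP; split.
    by have := @ge0_emeasurable_sum _ _ _ D f xpredT
      (fun k x Dx _ => f0 k x Dx) (fun k _ => mf k).
  rewrite (eq_integral F) => [|t /set_mem Dt]; first exact: le_lt_trans intF (ltry _).
  by rewrite gee0_abs// F0.
apply: filterS (integrable_ae mD iF) => t + Dt => /(_ Dt) Ft.
exists (fine (F t)) => n; rewrite -lee_fin fineK// EFinM.
apply: le_trans (nneseries_lim_ge n.+1 (fun m _ _ => f0 m t Dt)).
rewrite big_nat_recr//= leeDr// sume_ge0// => m _; exact: f0.
Unshelve. all: by end_near. Qed.

Lemma dyadic_coefSS (R : realType) (beta : R) n :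
  dyadic_coef beta n.+2 = 2 `^ beta * dyadic_coef beta n.+1.
Proof.
by rewrite /dyadic_coef -[n.+2%:R]nat1r mulrDr mulr1 powRD ?pnatr_eq0 ?implybT.
Qed.

Lemma in_ell2_sum_le (R : realType) (x : nat -> R) :
  in_ell2 x -> exists E, forall N, \sum_(n < N) x n.+1 ^+ 2 <= E.
Proof.
rewrite /in_ell2 => xoo.
have x0 n : (0 <= (`|x n| ^+ 2)%:E)%E by rewrite lee_fin sqr_ge0.
exists (fine (\sum_(1 <= n <oo) (`|x n| ^+ 2)%:E)%E) => N.
rewrite -lee_fin fineK; last by rewrite ge0_fin_numE// nneseries_ge0.
apply: le_trans (nneseries_lim_ge N.+1 (fun m _ _ => x0 m)).
rewrite big_add1/= big_mkord sumEFin lee_fin.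
by apply: ler_sum => n _; rewrite real_normK ?num_real.
Qed.

(** This avoids extracting a cube root of the bound. *)
Lemma le_of_cube_le (R : realType) (y M : R) : 0 <= y -> y ^+ 3 <= M -> y <= 1 + M.
Proof.
move=> y0 yM; have M0 : 0 <= M by apply: le_trans yM; rewrite exprn_ge0.
have [y1|/ltW y1] := leP y 1; first by rewrite (le_trans y1)// lerDl.
apply: (@le_trans _ _ (y ^+ 3)); first by rewrite ler_eXnr.
by rewrite (le_trans yM)// lerDr.
Qed.

Lemma cube_scaled (R : realType) (m c alpha y : R) : 0 <= c ->
  (m `^ (- alpha) * c `^ (1 / 3) * y) ^+ 3 =
  m `^ (- (3 * alpha)) * (c * y ^+ 3).
Proof.
move=> c0; rewrite !exprMn -!(powR_mulrn _ (powR_ge0 _ _)) -!powRrM.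
rewrite (_ : 1 / 3 * _ = 1); last by field.
by rewrite powRr1// -mulrA; congr (_ `^ _ * _); ring.
Qed.

(** * The almost everywhere bound *)

Theorem corollary11 (R : realType) (beta : R) (x : nat -> R)
    (X : nat -> R -> R) :
  0 < beta ->
  in_ell2 x ->
  (forall n : nat, (1 <= n)%N -> 0 <= x n) ->
  weak_solution beta x X ->
  forall alpha : R, 1 / 3 < alpha ->
  {ae @lebesgue_measure R, forall t : R, 0 < t ->
    (ereal_sup [set (n%:R `^ (- alpha) * dyadic_coef beta n `^ (1 / 3)
                     * X n t)%:E | n in [set n : nat | (1 <= n)%N]]
     < +oo)%E}.
Proof.
move=> beta0 /in_ell2_sum_le[E xE] x0 solX alpha alpha3.
have [_ Xx _] := solX.
have l1 : 1 <= 2 `^ beta :> R by rewrite -[leLHS](powRr0 2) ler_powR ?ler1n// ltW.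
have k1 : 0 < dyadic_coef beta 1 by apply: powR_gt0.
have k_ge0 n : 0 <= dyadic_coef beta n by case: n => //= n; exact: powR_ge0.
have XE n : \sum_(j < n) X j.+1 0 ^+ 2 <= E.
  by apply: le_trans (xE n); apply: ler_sum => j _; rewrite Xx.
have X0 n : 0 <= X n.+1 0 by rewrite Xx// x0.
have E0 : 0 <= E by apply: le_trans (xE 0%N); rewrite big_ord0.
have s0 : 0 < 3 * alpha - 1 by rewrite subr_gt0; lra.
have dX T n := weak_solution_primitive_on T n solX.
have X_ge0 T n t : 0 <= t <= T -> 0 <= X n.+1 t.
  exact: (dyadic_ge0 l1 erefl k1 (dyadic_coefSS beta) (dX T) X0).
have bounded (N : nat) : {ae @lebesgue_measure R, forall t, `[0, N.+1%:R]%classic t ->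
    exists M, forall n, n.+1%:R `^ (- (3 * alpha)) *
      (dyadic_coef beta n.+1 * X n.+1 t ^+ 3) <= M}.
  have T0 : 0 < N.+1%:R :> R by [].
  apply: (ae_bounded_of_summable_integral (C := 12 * (2 `^ beta) ^+ 2 * E)
    (S := 1 + (3 * alpha - 1)^-1)) => //.
  - move=> n; apply: subspace_continuous_measurable_fun => //.
    exact: (dyadic_cube_continuous (dX N.+1%:R)).
  - move=> n t; rewrite /= in_itv/= => tT.
    by rewrite mulr_ge0// exprn_ge0// (X_ge0 N.+1%:R).
  - by apply: mulr_ge0 => //; rewrite mulr_ge0 ?sqr_ge0.
  - move=> n; exact: (dyadic_cube_integral_le l1 erefl k1 (dyadic_coefSS beta) T0
      (dX N.+1%:R) X0 XE).
  - move=> M; have := p_series_le M s0.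
    by rewrite (_ : 1 + (3 * alpha - 1) = 3 * alpha); last by ring.
(* Countably many intervals [[0, N + 1]] cover all times. *)
have := ae_foralln bounded; apply: filterS => t tM t0.
have tT : 0 <= t <= (Num.bound t).+1%:R.
  rewrite ltW//= (le_trans (ltW (archi_boundP (ltW t0))))// ler_nat//.
have [|M XM] := tM (Num.bound t); first by rewrite /= in_itv.
apply: (@le_lt_trans _ _ (1 + M)%:E); last exact: ltry.
apply: ge_ereal_sup => _ [[//|n] _ <-]; rewrite lee_fin.
apply: le_of_cube_le; last by rewrite cube_scaled.
by rewrite mulr_ge0 ?mulr_ge0 ?powR_ge0//; exact: X_ge0 tT.
Qed.
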